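(* Let $\mathcal C$ be a semi-abelian category. The following are equivalent: (i) the only abelian object of $\mathcal C$ is the zero object; (ii) for every $n\ge2$, every object $A$ and subobjects $X_1,\dots,X_n\le A$, one has $[X_1,\dots,X_n]=X_1^{\bigvee_k X_k}\wedge\cdots\wedge X_n^{\bigvee_k X_k}$; (iii) for every $n\ge2$, every object $A$ is $n$-perfect, i.e. the $n$-ary Higgins commutator $[A,\dots,A]$ equals $A$.
   Context: Semi-abelian category: pointed, Barr-exact, protomodular, with binary coproducts. For objects $X_1,\dots,X_n$ ($n\ge2$) the cosmash product $X_1\diamond\cdots\diamond X_n$ is the kernel of the morphism $X_1+\cdots+X_n\to\prod_{k=1}^n\coprod_{j\ne k}X_j$ whose component to $\coprod_{j\ne k}X_j$ is the coproduct injection on $X_l$ for $l\ne k$ and $0$ on $X_k$. For subobjects $x_i\colon X_i\rightarrowtail A$, the Higgins commutator $[X_1,\dots,X_n]$ is the regular image of $X_1\diamond\cdots\diamond X_n$ under $\langle x_1,\dots,x_n\rangle$. $X_i^{\bigvee_k X_k}$ is the normal closure of $X_i$ in the join $X_1\vee\cdots\vee X_n$. An object is abelian if it Huq-commutes with itself (equivalently $[A,A]=0$). *)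

(* Defs.v *)
From mathcomp Require Import all_boot.

Set Implicit Arguments.
Unset Strict Implicit.
Unset Printing Implicit Defensive.

Record Category := Cat {
  ob :> Type;
  hom : ob -> ob -> Type;
  idm : forall A, hom A A;
  comp : forall A B D, hom B D -> hom A B -> hom A D;
  comp_assoc : forall A B D E (f : hom A B) (g : hom B D) (h : hom D E),
      comp h (comp g f) = comp (comp h g) f;
  comp_idl : forall A B (f : hom A B), comp (idm B) f = f;
  comp_idr : forall A B (f : hom A B), comp f (idm A) = f }.

Arguments hom {c} _ _.
Arguments idm {c} A.
Arguments comp {c A B D} _ _.

Notation "A ~> B" := (hom A B) (at level 90, no associativity).
Notation "g ∘ f" := (comp g f) (at level 40, left associativity).

Section CatDefs.
Variable C : Category.
Implicit Types A B D P Q R S K X Y Z : C.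

Definition mono A B (f : A ~> B) : Prop :=
  forall X (g h : X ~> A), f ∘ g = f ∘ h -> g = h.

Definition is_iso A B (f : A ~> B) : Prop :=
  exists g : B ~> A, g ∘ f = idm A /\ f ∘ g = idm B.

Definition is_initial Z : Prop := forall A, exists! f : Z ~> A, True.
Definition is_terminal Z : Prop := forall A, exists! f : A ~> Z, True.
Definition is_zero_obj Z : Prop := is_initial Z /\ is_terminal Z.

Definition is_zero_mor A B (f : A ~> B) : Prop :=
  exists Z (a : A ~> Z) (b : Z ~> B), is_zero_obj Z /\ f = b ∘ a.

Definition pointed : Prop := exists Z, is_zero_obj Z.

Definition is_pullback A B D (f : A ~> D) (g : B ~> D) P (p1 : P ~> A) (p2 : P ~> B)
  : Prop :=
  f ∘ p1 = g ∘ p2 /\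
  forall X (q1 : X ~> A) (q2 : X ~> B), f ∘ q1 = g ∘ q2 ->
    exists! h : X ~> P, p1 ∘ h = q1 /\ p2 ∘ h = q2.

Definition is_coprod (I : Type) (X : I -> C) S (inj : forall i, X i ~> S) : Prop :=
  forall Y (f : forall i, X i ~> Y), exists! h : S ~> Y, forall i, h ∘ inj i = f i.

Definition is_prod (I : Type) (X : I -> C) P (pr : forall i, P ~> X i) : Prop :=
  forall Y (f : forall i, Y ~> X i), exists! h : Y ~> P, forall i, pr i ∘ h = f i.

Definition is_coequalizer R A (u v : R ~> A) Q (e : A ~> Q) : Prop :=
  e ∘ u = e ∘ v /\
  forall X (g : A ~> X), g ∘ u = g ∘ v -> exists! h : Q ~> X, h ∘ e = g.

Definition regular_epi A Q (e : A ~> Q) : Prop :=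
  exists R (u v : R ~> A), is_coequalizer u v e.

Definition is_kernel_pair A B (f : A ~> B) R (r1 r2 : R ~> A) : Prop :=
  is_pullback f f r1 r2.

Definition is_kernel A B (f : A ~> B) K (k : K ~> A) : Prop :=
  is_zero_mor (f ∘ k) /\
  forall X (g : X ~> A), is_zero_mor (f ∘ g) -> exists! h : X ~> K, k ∘ h = g.

Definition has_finite_limits : Prop :=
  (exists T, is_terminal T) /\
  (forall A B D (f : A ~> D) (g : B ~> D),
      exists P (p1 : P ~> A) (p2 : P ~> B), is_pullback f g p1 p2).

Definition has_binary_coproducts : Prop :=
  forall A B, exists S (inj : forall b : bool, (if b then A else B) ~> S),
    is_coprod (X := fun b : bool => if b then A else B) inj.

Definition regular_category : Prop :=
  has_finite_limits /\
  (forall A B (f : A ~> B) R (r1 r2 : R ~> A), is_kernel_pair f r1 r2 ->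
     exists Q (e : A ~> Q), is_coequalizer r1 r2 e) /\
  (forall A B D (f : A ~> D) (g : B ~> D) P (p1 : P ~> A) (p2 : P ~> B),
     is_pullback f g p1 p2 -> regular_epi f -> regular_epi p2).

Definition jointly_monic R A (r1 r2 : R ~> A) : Prop :=
  forall X (g h : X ~> R), r1 ∘ g = r1 ∘ h -> r2 ∘ g = r2 ∘ h -> g = h.

Definition is_equivalence_relation R A (r1 r2 : R ~> A) : Prop :=
  jointly_monic r1 r2 /\
  (exists d : A ~> R, r1 ∘ d = idm A /\ r2 ∘ d = idm A) /\
  (exists s : R ~> R, r1 ∘ s = r2 /\ r2 ∘ s = r1) /\
  (forall P (p1 p2 : P ~> R), is_pullback r2 r1 p1 p2 ->
     exists t : P ~> R, r1 ∘ t = r1 ∘ p1 /\ r2 ∘ t = r2 ∘ p2).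

Definition effective_relation R A (r1 r2 : R ~> A) : Prop :=
  exists B (f : A ~> B), is_kernel_pair f r1 r2.

Definition barr_exact : Prop :=
  regular_category /\
  forall R A (r1 r2 : R ~> A), is_equivalence_relation r1 r2 -> effective_relation r1 r2.

(* ---------- protomodularity (pointed case) ----------
   Pulling back points along the initial maps 0 -> B (i.e. taking kernels)
   reflects isomorphisms: a morphism of points over B inducing an iso on
   kernels is an iso. *)
Definition protomodular : Prop :=
  forall A A' B (p : A ~> B) (s : B ~> A) (p' : A' ~> B) (s' : B ~> A')
         (u : A ~> A') K (k : K ~> A) K' (k' : K' ~> A') (w : K ~> K'),
    p ∘ s = idm B -> p' ∘ s' = idm B ->
    p' ∘ u = p -> u ∘ s = s' ->
    is_kernel p k -> is_kernel p' k' -> u ∘ k = k' ∘ w ->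
    is_iso w -> is_iso u.

Definition semi_abelian : Prop :=
  pointed /\ barr_exact /\ protomodular /\ has_binary_coproducts.

Definition le_sub M N A (m : M ~> A) (n : N ~> A) : Prop := exists h : M ~> N, n ∘ h = m.
Definition eq_sub M N A (m : M ~> A) (n : N ~> A) : Prop := le_sub m n /\ le_sub n m.

Definition is_reg_image X A (f : X ~> A) M (m : M ~> A) : Prop :=
  mono m /\ exists e : X ~> M, regular_epi e /\ m ∘ e = f.

Definition is_normal M A (m : M ~> A) : Prop := exists B (f : A ~> B), is_kernel f m.

Definition is_join n (X : 'I_n -> C) A (x : forall i, X i ~> A) J (j : J ~> A) : Prop :=
  mono j /\ (forall i, le_sub (x i) j) /\
  (forall M (m : M ~> A), mono m -> (forall i, le_sub (x i) m) -> le_sub j m).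

Definition is_meet n (Y : 'I_n -> C) A (y : forall i, Y i ~> A) M (m : M ~> A) : Prop :=
  mono m /\ (forall i, le_sub m (y i)) /\
  (forall N (nn : N ~> A), mono nn -> (forall i, le_sub nn (y i)) -> le_sub nn m).

Definition is_normal_closure X J (x : X ~> J) M (m : M ~> J) : Prop :=
  is_normal m /\ le_sub x m /\
  (forall N (nn : N ~> J), is_normal nn -> le_sub x nn -> le_sub m nn).

(* kk : K -> S is the kernel of the canonical map
   S = X_1 + ... + X_n  -->  prod_k (coprod_{j <> k} X_j),
   i.e. K is the cosmash product X_1 ⋄ ... ⋄ X_n. *)
Definition is_cosmash n (X : 'I_n -> C) S (inj : forall i, X i ~> S) K (kk : K ~> S)
  : Prop :=
  is_coprod (X := X) inj /\
  exists (Sk : 'I_n -> C)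
         (injk : forall k (j : {j : 'I_n | j != k}), X (proj1_sig j) ~> Sk k)
         P (pr : forall k, P ~> Sk k) (m : S ~> P),
    (forall k, is_coprod (X := fun j : {j : 'I_n | j != k} => X (proj1_sig j)) (injk k)) /\
    is_prod (X := Sk) pr /\
    (forall k l (hlk : l != k), pr k ∘ m ∘ inj l = injk k (exist _ l hlk)) /\
    (forall k, is_zero_mor (pr k ∘ m ∘ inj k)) /\
    is_kernel m kk.

Definition is_higgins n (X : 'I_n -> C) A (x : forall i, X i ~> A) Cm (c : Cm ~> A)
  : Prop :=
  exists S (inj : forall i, X i ~> S) K (kk : K ~> S) (a : S ~> A),
    is_cosmash inj kk /\ (forall i, a ∘ inj i = x i) /\ is_reg_image (a ∘ kk) c.

Definition huq_commute X Y A (x : X ~> A) (y : Y ~> A) : Prop :=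
  exists P (pr : forall b : bool, P ~> (if b then X else Y))
         (i1 : X ~> P) (i2 : Y ~> P) (phi : P ~> A),
    is_prod (X := fun b : bool => if b then X else Y) pr /\
    pr true ∘ i1 = idm X /\ is_zero_mor (pr false ∘ i1) /\
    is_zero_mor (pr true ∘ i2) /\ pr false ∘ i2 = idm Y /\
    phi ∘ i1 = x /\ phi ∘ i2 = y.

Definition abelian_object A : Prop := huq_commute (idm A) (idm A).

Definition only_zero_abelian : Prop :=
  forall A, abelian_object A -> is_zero_obj A.

Definition higgins_meet_formula : Prop :=
  forall (n : nat), 2 <= n ->
  forall A (X : 'I_n -> C) (x : forall i, X i ~> A), (forall i, mono (x i)) ->
  forall Cm (c : Cm ~> A), is_higgins x c ->
  forall J (j : J ~> A), is_join x j ->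
  forall (xJ : forall i, X i ~> J), (forall i, j ∘ xJ i = x i) ->
  forall (N : 'I_n -> C) (nc : forall i, N i ~> J),
    (forall i, is_normal_closure (xJ i) (nc i)) ->
  forall M (m : M ~> J), is_meet nc m ->
    eq_sub c (j ∘ m).

Definition all_perfect : Prop :=
  forall (n : nat), 2 <= n ->
  forall A Cm (c : Cm ~> A),
    is_higgins (X := fun _ : 'I_n => A) (fun _ => idm A) c ->
    eq_sub c (idm A).

End CatDefs.

(* Main.v *)
Require Import Defs.
From mathcomp Require Import all_boot.

(* Suppose only zero is abelian, and let K be the kernel of S -> S_1 and L that of S -> S_2,
   with a : S -> J a regular epimorphism. The binary commutator [P, P] is normal with abelian
   quotient, so every P is the image of its cosmash square P <> P under the fold map. If
   r : P -> J lifts, after a covering of P, through both K and L, then the copairing of the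
   two lifts restricted to P <> P lands in the meet of K and L and still covers r: direct
   images along a commute with finite meets of kernels.
   Apply this to S = X_1 + ... + X_n and K_i = ker(S -> coprod_(j != i) X_j). The meet of the
   K_i is the cosmash product, whose image is [X_1, ..., X_n], while a(K_i) is normal and
   contains X_i, so the meet of the normal closures lies in that image. Normality of images
   comes from difunctionality of relations. The converse (iii) -> (i) needs only n = 2. *)

Set Implicit Arguments.
Unset Strict Implicit.
Unset Printing Implicit Defensive.

Section SemiAbelian.

Variable C : Category.
Hypothesis HC : semi_abelian C.

(** * Components of the hypothesis, and zero morphisms *)

Lemma semi_abelian_pointed : pointed C.
Proof. by case: HC. Qed.

Lemma semi_abelian_regular : regular_category C.
Proof. by case: HC => _ [[]]. Qed.

Lemma semi_abelian_exact R A (r1 r2 : hom (c := C) R A) :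
  is_equivalence_relation r1 r2 -> effective_relation r1 r2.
Proof. by case: HC => _ [[_ H] _]; apply: H. Qed.

Lemma semi_abelian_protomodular : protomodular C.
Proof. by case: HC => _ [_ []]. Qed.

Lemma zero_mor_exists (A B : C) : exists f : A ~> B, is_zero_mor f.
Proof.
case: semi_abelian_pointed => Z HZ.
have [a _] := HZ.2 A; have [b _] := HZ.1 B.
by exists (b ∘ a), Z, a, b.
Qed.

Lemma zero_mor_unique (A B : C) (f g : A ~> B) :
  is_zero_mor f -> is_zero_mor g -> f = g.
Proof.
move=> [Z [a [b [HZ ->]]]] [Z' [a' [b' [HZ' ->]]]].
(* The two factorisations may use different zero objects; [t] compares them. *)
have [t _] := HZ.1 Z'.
have [x [_ Ux]] := HZ.1 B; have [y [_ Uy]] := HZ'.2 A.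
have -> : b = b' ∘ t by rewrite -(Ux b) // -(Ux (b' ∘ t)).
by rewrite -comp_assoc -(Uy (t ∘ a)) // (Uy a').
Qed.

Lemma zero_mor_compl (A B D : C) (g : B ~> D) (f : A ~> B) :
  is_zero_mor f -> is_zero_mor (g ∘ f).
Proof.
by move=> [Z [a [b [HZ ->]]]]; exists Z, a, (g ∘ b); rewrite comp_assoc.
Qed.

Lemma zero_mor_compr (A B D : C) (g : B ~> D) (f : A ~> B) :
  is_zero_mor g -> is_zero_mor (g ∘ f).
Proof.
by move=> [Z [a [b [HZ ->]]]]; exists Z, (a ∘ f), b; rewrite comp_assoc.
Qed.

Lemma zero_mor_mono (A B D : C) (m : B ~> D) (f : A ~> B) :
  mono m -> is_zero_mor (m ∘ f) -> is_zero_mor f.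
Proof.
move=> Hm H; have [z Hz] := zero_mor_exists A B.
by rewrite (Hm _ f z) //; apply: zero_mor_unique => //; apply: zero_mor_compl.
Qed.

Lemma zero_mor_from_zero (Z A : C) (f : Z ~> A) : is_zero_obj Z -> is_zero_mor f.
Proof. by move=> HZ; exists Z, (idm Z), f; rewrite comp_idr. Qed.

Lemma zero_mor_to_zero (Z A : C) (f : A ~> Z) : is_zero_obj Z -> is_zero_mor f.
Proof. by move=> HZ; exists Z, f, (idm Z); rewrite comp_idl. Qed.

Lemma zero_obj_of_idm (A : C) : is_zero_mor (idm A) -> is_zero_obj A.
Proof.
move=> H; split=> B; have := zero_mor_exists A B; have := zero_mor_exists B A.
  move=> _ [f Hf]; exists f; split=> // g _.
  by apply: zero_mor_unique => //; rewrite -(comp_idr g); apply: zero_mor_compl.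
move=> [f Hf] _; exists f; split=> // g _.
by apply: zero_mor_unique => //; rewrite -(comp_idl g); apply: zero_mor_compr.
Qed.

(** * Monomorphisms and pullbacks *)

Lemma mono_comp_inv (A B D : C) (m : B ~> D) (f : A ~> B) : mono (m ∘ f) -> mono f.
Proof. by move=> H X g h E; apply: H; rewrite -!comp_assoc E. Qed.

Lemma mono_comp (A B D : C) (m : B ~> D) (f : A ~> B) : mono m -> mono f -> mono (m ∘ f).
Proof. by move=> Hm Hf X g h; rewrite -!comp_assoc => /Hm /Hf. Qed.

(* The [jointly_monic] of the definitions, for spans with two different codomains. *)
Definition jointly_mono (R A B : C) (r1 : R ~> A) (r2 : R ~> B) : Prop :=
  forall X (g h : X ~> R), r1 ∘ g = r1 ∘ h -> r2 ∘ g = r2 ∘ h -> g = h.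

Lemma pullback_exists (A B D : C) (f : A ~> D) (g : B ~> D) :
  exists P (p1 : P ~> A) (p2 : P ~> B), is_pullback f g p1 p2.
Proof. by case: semi_abelian_regular => [[_ H] _]; apply: H. Qed.

Lemma pullback_lift (A B D : C) (f : A ~> D) (g : B ~> D) P (p1 : P ~> A) (p2 : P ~> B)
    X (q1 : X ~> A) (q2 : X ~> B) :
  is_pullback f g p1 p2 -> f ∘ q1 = g ∘ q2 ->
  exists h : X ~> P, p1 ∘ h = q1 /\ p2 ∘ h = q2.
Proof. by move=> [_ H] /H [h [? _]]; exists h. Qed.

Lemma pullback_jointly_monic (A B D : C) (f : A ~> D) (g : B ~> D) P
    (p1 : P ~> A) (p2 : P ~> B) :
  is_pullback f g p1 p2 -> jointly_mono p1 p2.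
Proof.
move=> [E H] X u v E1 E2.
have [|h [_ U]] := H X (p1 ∘ u) (p2 ∘ u); first by rewrite !comp_assoc E.
by rewrite -(U u) // -(U v).
Qed.

Lemma pullback_mono (A B D : C) (f : A ~> D) (g : B ~> D) P (p1 : P ~> A) (p2 : P ~> B) :
  is_pullback f g p1 p2 -> mono g -> mono p1.
Proof.
move=> HP Hg X u v E; apply: (pullback_jointly_monic HP) => //.
by apply: Hg; rewrite !comp_assoc -HP.1 -!comp_assoc E.
Qed.

Lemma regular_epi_pullback (A B D : C) (f : A ~> D) (g : B ~> D) P
    (p1 : P ~> A) (p2 : P ~> B) :
  is_pullback f g p1 p2 -> regular_epi f -> regular_epi p2.
Proof. by case: semi_abelian_regular => _ [_ H]; apply: H. Qed.

(** * Products, equalizers and kernels *)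

(** A variant of [is_prod] without a family over [bool], which avoids dependent matches in the types
    of the projections. *)
Definition is_prod2 (A B P : C) (p1 : P ~> A) (p2 : P ~> B) : Prop :=
  forall X (q1 : X ~> A) (q2 : X ~> B), exists! h : X ~> P, p1 ∘ h = q1 /\ p2 ∘ h = q2.

Lemma prod2_exists (A B : C) : exists P (p1 : P ~> A) (p2 : P ~> B), is_prod2 p1 p2.
Proof.
case: semi_abelian_pointed => Z HZ.
have [a [_ Ua]] := HZ.2 A; have [b _] := HZ.2 B.
(* The product is the pullback over a zero object, where every square commutes. *)
have [P [p1 [p2 [_ H]]]] := pullback_exists a b.
exists P, p1, p2 => X q1 q2; apply: H.
by apply: zero_mor_unique; apply: zero_mor_to_zero.
Qed.

Lemma prod2_pair (A B P : C) (p1 : P ~> A) (p2 : P ~> B) X (q1 : X ~> A) (q2 : X ~> B) :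
  is_prod2 p1 p2 -> exists h : X ~> P, p1 ∘ h = q1 /\ p2 ∘ h = q2.
Proof. by move=> /(_ X q1 q2) [h [? _]]; exists h. Qed.

Lemma prod2_jointly_monic (A B P : C) (p1 : P ~> A) (p2 : P ~> B) :
  is_prod2 p1 p2 -> jointly_mono p1 p2.
Proof.
move=> H X u v E1 E2.
by have [h [_ U]] := H X (p1 ∘ u) (p2 ∘ u); rewrite -(U u) // -(U v).
Qed.

(** The equalizer is the pullback of [(u, v) : A -> B x B] along the diagonal. *)
Lemma equalizer_exists (A B : C) (u v : A ~> B) :
  exists E (m : E ~> A), [/\ mono m, u ∘ m = v ∘ m &
    forall X (q : X ~> A), u ∘ q = v ∘ q -> le_sub q m].
Proof.
have [P [p1 [p2 HP]]] := prod2_exists B B.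
have [w [w1 w2]] := prod2_pair u v HP.
have [d [d1 d2]] := prod2_pair (idm B) (idm B) HP.
have [E [m [n Hmn]]] := pullback_exists w d.
have Hd : mono d.
  by move=> X g h Eq; rewrite -(comp_idl g) -(comp_idl h) -d1 -!comp_assoc Eq.
exists E, m; split.
- exact: pullback_mono Hmn Hd.
- by rewrite -w1 -w2 -!comp_assoc Hmn.1 !comp_assoc d1 d2.
- move=> X q Eq; have [|h [h1 _]] := @pullback_lift _ _ _ _ _ _ _ _ X q (u ∘ q) Hmn.
    apply: (prod2_jointly_monic HP); first by rewrite !comp_assoc w1 d1 comp_idl.
    by rewrite !comp_assoc w2 d2 comp_idl.
  by exists h.
Qed.

Lemma kernel_exists (A B : C) (f : A ~> B) : exists K (k : K ~> A), is_kernel f k.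
Proof.
case: semi_abelian_pointed => Z HZ; have [o _] := HZ.1 B.
have [K [k [t HK]]] := pullback_exists f o.
exists K, k; split=> [|X g Hg].
  by rewrite HK.1; apply: zero_mor_compr; apply: zero_mor_from_zero.
have [y _] := HZ.2 X.
have [|h [h1 h2]] := @pullback_lift _ _ _ _ _ _ _ _ X g y HK.
  by apply: zero_mor_unique => //; apply: zero_mor_compr; apply: zero_mor_from_zero.
exists h; split=> // h' h1'; apply: (pullback_jointly_monic HK); first by rewrite h1.
by apply: zero_mor_unique; apply: zero_mor_to_zero.
Qed.

Lemma kernel_zero (A B : C) (f : A ~> B) K (k : K ~> A) :
  is_kernel f k -> is_zero_mor (f ∘ k).
Proof. by case. Qed.

Lemma kernel_lift (A B : C) (f : A ~> B) K (k : K ~> A) X (g : X ~> A) :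
  is_kernel f k -> is_zero_mor (f ∘ g) -> le_sub g k.
Proof. by move=> [_ H] /H [h [? _]]; exists h. Qed.

Lemma kernel_mono (A B : C) (f : A ~> B) K (k : K ~> A) : is_kernel f k -> mono k.
Proof.
move=> [H0 H] X u v E.
have [|h [_ U]] := H X (k ∘ u); first by rewrite comp_assoc; apply: zero_mor_compr.
by rewrite -(U u) // -(U v).
Qed.

Lemma mono_kernel_intro (A B : C) (f : A ~> B) K (k : K ~> A) :
  mono k -> is_zero_mor (f ∘ k) ->
  (forall X (g : X ~> A), is_zero_mor (f ∘ g) -> le_sub g k) -> is_kernel f k.
Proof.
move=> Hk H0 H; split=> // X g /H [h E]; exists h; split=> // h' E'.
by apply: Hk; rewrite E.
Qed.

(** * Regular epimorphisms and images *)

Lemma regular_epi_epi (A B : C) (e : A ~> B) X (u v : B ~> X) :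
  regular_epi e -> u ∘ e = v ∘ e -> u = v.
Proof.
move=> [R [x [y [E H]]]] Euv.
have [|h [_ U]] := H X (u ∘ e); first by rewrite -!comp_assoc E.
by rewrite -(U u) // -(U v).
Qed.

(** Orthogonality to jointly monic pairs, so that it applies to relations given as spans. *)
Lemma regular_epi_fill_pair (A B T X Y : C) (e : A ~> B) (t1 : T ~> X) (t2 : T ~> Y)
    (u : A ~> T) (v1 : B ~> X) (v2 : B ~> Y) :
  regular_epi e -> jointly_mono t1 t2 -> t1 ∘ u = v1 ∘ e -> t2 ∘ u = v2 ∘ e ->
  exists d : B ~> T, [/\ d ∘ e = u, t1 ∘ d = v1 & t2 ∘ d = v2].
Proof.
move=> He Ht E1 E2; have [R [x [y [E H]]]] := He.
have [|d [Hd _]] := H T u.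
  apply: Ht; first by rewrite !comp_assoc E1 -!comp_assoc E.
  by rewrite !comp_assoc E2 -!comp_assoc E.
by exists d; split=> //; apply: (regular_epi_epi He); rewrite -comp_assoc Hd.
Qed.

Lemma regular_epi_fill (A B T X : C) (e : A ~> B) (m : T ~> X)
    (u : A ~> T) (v : B ~> X) :
  regular_epi e -> mono m -> m ∘ u = v ∘ e ->
  exists d : B ~> T, d ∘ e = u /\ m ∘ d = v.
Proof.
move=> He Hm E.
have Hmm : jointly_mono m m by move=> Z g h E1 _; apply: Hm.
by have [d [? ? _]] := regular_epi_fill_pair He Hmm E E; exists d.
Qed.

Lemma split_epi_regular (A B : C) (e : A ~> B) (s : B ~> A) :
  e ∘ s = idm B -> regular_epi e.
Proof.
move=> E; exists A, (idm A), (s ∘ e); split.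
  by rewrite comp_idr comp_assoc E comp_idl.
move=> X g; rewrite comp_idr comp_assoc => Eg; exists (g ∘ s); split=> // h <-.
by rewrite -comp_assoc E comp_idr.
Qed.

Lemma reg_image_exists (X A : C) (f : X ~> A) :
  exists M (m : M ~> A), is_reg_image f m.
Proof.
have [R [r1 [r2 HR]]] := pullback_exists f f.
have [_ [/(_ _ _ _ _ _ _ HR) [Q [e He]] _]] := semi_abelian_regular.
have [m [Hm _]] := He.2 _ f HR.1.
have Re : regular_epi e by exists R, r1, r2.
exists Q, m; split; last by exists e.
(* For [m] to be mono, lift [g] and [h] through [e] after a covering: the lifts have the same image
   under [f], so they give a point of the kernel pair, which [e] coequalizes. *)
move=> Z g h Egh.
have [Z1 [u [q1 H1]]] := pullback_exists e g.
have [Z2 [v [q2 H2]]] := pullback_exists e (h ∘ q1).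
have Rq1 := regular_epi_pullback H1 Re; have Rq2 := regular_epi_pullback H2 Re.
have [|w [w1 w2]] := @pullback_lift _ _ _ _ _ _ _ _ Z2 (u ∘ q2) v HR.
  rewrite -Hm -(comp_assoc v) H2.1 !comp_assoc -(comp_assoc u) H1.1.
  by rewrite comp_assoc Egh.
apply: (regular_epi_epi Rq1); apply: (regular_epi_epi Rq2).
by rewrite -H1.1 -H2.1 -comp_assoc -w1 -w2 !comp_assoc He.1.
Qed.

(** The mono part of the image of [f] splits by hypothesis, hence is invertible, and [f] inherits
    the coequalizer property of its regular epi part. *)
Lemma regular_epi_of_strong (X A : C) (f : X ~> A) :
  (forall M (m : M ~> A), mono m -> le_sub f m -> exists s, m ∘ s = idm A) ->
  regular_epi f.
Proof.
move=> H; have [M [m [Hm [e [He Ef]]]]] := reg_image_exists f.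
have [s Es] : exists s, m ∘ s = idm A by apply: H => //; exists e.
have Es' : s ∘ m = idm M by apply: Hm; rewrite comp_assoc Es comp_idl comp_idr.
have [R [x [y [E U]]]] := He.
exists R, x, y; split; first by rewrite -Ef -!comp_assoc E.
move=> Y g /U [h [Eh Uh]]; exists (h ∘ s); split.
  by rewrite -Ef comp_assoc -(comp_assoc m) Es' comp_idr.
move=> h' E'; rewrite (Uh (h' ∘ m)); first by rewrite -comp_assoc Es comp_idr.
by rewrite -comp_assoc Ef.
Qed.

Lemma regular_epi_comp (A B D : C) (e : A ~> B) (e' : B ~> D) :
  regular_epi e -> regular_epi e' -> regular_epi (e' ∘ e).
Proof.
move=> He He'; apply: regular_epi_of_strong => M m Hm [u Eu].
have [d [_ Ed]] := regular_epi_fill He Hm Eu.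
have [|s [_ Es]] := @regular_epi_fill _ _ _ _ _ _ d (idm D) He' Hm.
  by rewrite comp_idl.
by exists s.
Qed.

(** * Consequences of protomodularity *)

(** [p ∘ m] is split by the lift of [s] and has the same kernel object as [p], so protomodularity
    makes [m] invertible. *)
Lemma split_extension_strong (A B K : C) (p : A ~> B) (s : B ~> A) (k : K ~> A)
    M (m : M ~> A) :
  p ∘ s = idm B -> is_kernel p k -> mono m -> le_sub k m -> le_sub s m ->
  exists t, m ∘ t = idm A.
Proof.
move=> Eps Hk Hm [k' Ek] [s' Es].
have Hk' : is_kernel (p ∘ m) k'.
  apply: mono_kernel_intro; last first.
  - move=> X g; rewrite -comp_assoc => /(kernel_lift Hk) [h Eh].
    by exists h; apply: Hm; rewrite comp_assoc Ek.
  - by rewrite -comp_assoc Ek; apply: kernel_zero.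
  - by apply: (@mono_comp_inv _ _ _ m); rewrite Ek; apply: kernel_mono Hk.
suff [t [_ Et]] : is_iso m by exists t.
apply: (@semi_abelian_protomodular _ _ _ (p ∘ m) s' p s m _ k' _ k (idm K)) => //.
- by rewrite -comp_assoc Es.
- by rewrite comp_idr.
- by exists (idm K); rewrite !comp_idl.
Qed.

Lemma split_extension_jointly_epic (A B K Q : C) (p : A ~> B) (s : B ~> A) (k : K ~> A)
    (u v : A ~> Q) :
  p ∘ s = idm B -> is_kernel p k -> u ∘ k = v ∘ k -> u ∘ s = v ∘ s -> u = v.
Proof.
move=> Eps Hk E1 E2; have [M [m [Hm Em Um]]] := equalizer_exists u v.
have [t Et] := split_extension_strong Eps Hk Hm (Um _ _ E1) (Um _ _ E2).
by rewrite -(comp_idr u) -(comp_idr v) -Et !comp_assoc Em.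
Qed.

(* In the object E of triples ((x,y),(x',y),(x',y')) of W, the projection onto the last
   two entries is split by doubling (x',y); both its section and its kernel lie in the
   subobject of triples with (x,y') in W, which is therefore all of E. *)
Lemma difunctional (W X Y : C) (w1 : W ~> X) (w2 : W ~> Y) Z (a b c : Z ~> W) :
  jointly_mono w1 w2 -> w2 ∘ a = w2 ∘ b -> w1 ∘ b = w1 ∘ c ->
  exists d : Z ~> W, w1 ∘ d = w1 ∘ a /\ w2 ∘ d = w2 ∘ c.
Proof.
move=> HW Eab Ebc.
have [G [g1 [g2 HG]]] := pullback_exists w1 w1.
have [E [e1 [e2 HE]]] := pullback_exists w2 (w2 ∘ g1).
have [|s [s1 s2]] := @pullback_lift _ _ _ _ _ _ _ _ _ g1 (idm G) HE.
  by rewrite comp_idr.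
have [K [k Hk]] := kernel_exists e2.
have [P [p1 [p2 HP]]] := prod2_exists X Y.
have [mu [mu1 mu2]] := prod2_pair w1 w2 HP.
have [nu [nu1 nu2]] := prod2_pair (w1 ∘ e1) (w2 ∘ g2 ∘ e2) HP.
have [F [f1 [f2 HF]]] := pullback_exists nu mu.
have Hmu : mono mu.
  by move=> V u v Euv; apply: HW; rewrite -?mu1 -?mu2 -!comp_assoc Euv.
have [||t Et] := split_extension_strong s2 Hk (pullback_mono HF Hmu).
(* On the kernel the last two entries vanish, so [y = y' = 0] and [(x,y')] is the first entry. *)
- have [|h [h1 _]] := @pullback_lift _ _ _ _ _ _ _ _ _ k (e1 ∘ k) HF; last by exists h.
  apply: (prod2_jointly_monic HP); rewrite !comp_assoc ?nu1 ?mu1 ?nu2 ?mu2 //.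
  rewrite HE.1 -!comp_assoc.
  by apply: zero_mor_unique; do 2!apply: zero_mor_compl; apply: kernel_zero.
(* On the section [x = x'], so [(x,y')] is the last entry. *)
- have [|h [h1 _]] := @pullback_lift _ _ _ _ _ _ _ _ _ s g2 HF; last by exists h.
  apply: (prod2_jointly_monic HP); rewrite !comp_assoc ?nu1 ?mu1 ?nu2 ?mu2.
    by rewrite -comp_assoc s1 HG.1.
  by rewrite -comp_assoc s2 comp_idr.
have [y [y1 y2]] := pullback_lift HG Ebc.
have [|z [z1 z2]] := @pullback_lift _ _ _ _ _ _ _ _ _ a y HE.
  by rewrite -comp_assoc y1.
exists (f2 ∘ t ∘ z); split.
  rewrite -mu1 -!comp_assoc (comp_assoc _ f2) -HF.1 -comp_assoc (comp_assoc z) Et.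
  by rewrite comp_idl comp_assoc nu1 -comp_assoc z1 comp_assoc mu1.
rewrite -mu2 -!comp_assoc (comp_assoc _ f2) -HF.1 -comp_assoc (comp_assoc z) Et.
by rewrite comp_idl comp_assoc nu2 -!comp_assoc z2 y2 comp_assoc mu2.
Qed.

(** The kernel pair of [g] is split by the diagonal, so [f ∘ r1 = f ∘ r2] can be checked there and
    on the kernel of [r2], where [r1] lands in the kernel of [g]. *)
Lemma regular_epi_cokernel (S P Q K : C) (g : S ~> P) (k : K ~> S) (f : S ~> Q) :
  regular_epi g -> is_kernel g k -> is_zero_mor (f ∘ k) ->
  exists h : P ~> Q, h ∘ g = f.
Proof.
move=> Hg Hk Hf; have [R0 [x [y [Exy U]]]] := Hg.
have [R [r1 [r2 HR]]] := pullback_exists g g.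
have [d [d1 d2]] := pullback_lift HR (erefl (g ∘ idm S)).
have [L [l Hl]] := kernel_exists r2.
have Er : f ∘ r1 = f ∘ r2.
  apply: (split_extension_jointly_epic d2 Hl).
    apply: zero_mor_unique; rewrite -comp_assoc; last first.
      by apply: zero_mor_compl; apply: kernel_zero.
    have [|h <-] := @kernel_lift _ _ _ _ _ _ (r1 ∘ l) Hk.
      rewrite comp_assoc HR.1 -comp_assoc.
      by apply: zero_mor_compl; apply: kernel_zero.
    by rewrite comp_assoc; apply: zero_mor_compr.
  by rewrite -!comp_assoc d1 d2.
have [h [h1 h2]] := pullback_lift HR Exy.
by have [|j [Ej _]] := U Q f; [rewrite -h1 -h2 !comp_assoc Er | exists j].
Qed.

(** The Mal'tsev property: difunctionality on [(y,y), (x,y), (x,x)] gives symmetry, and on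
    [(x,y), (y,y), (y,z)] transitivity. *)
Lemma reflexive_relation_equivalence (T J : C) (t1 t2 : T ~> J) (d : J ~> T) :
  jointly_mono t1 t2 -> t1 ∘ d = idm J -> t2 ∘ d = idm J ->
  is_equivalence_relation t1 t2.
Proof.
move=> HT d1 d2; split=> //; split; first by exists d.
split.
  have [||s [s1 s2]] := @difunctional _ _ _ t1 t2 T (d ∘ t2) (idm T) (d ∘ t1) HT.
  - by rewrite comp_assoc d2 comp_idl comp_idr.
  - by rewrite comp_assoc d1 comp_idl comp_idr.
  by exists s; rewrite s1 s2 !comp_assoc d1 d2 !comp_idl.
move=> P p1 p2 [E _].
have [||s [s1 s2]] := @difunctional _ _ _ t1 t2 P p1 (d ∘ (t2 ∘ p1)) p2 HT.
- by rewrite (comp_assoc _ d) d2 comp_idl.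
- by rewrite (comp_assoc _ d) d1 comp_idl.
by exists s.
Qed.

(* The direct image along a of the kernel pair of f is reflexive, hence effective. For an
   element related to 0 by it, difunctionality of the image of (f, a) in B x J, applied
   to (f r1, a r1), (f r2, 0) and (0, 0) with f r1 = f r2, gives a preimage in ker f. *)
Lemma reg_image_kernel_normal (S B J K I : C) (f : S ~> B) (k : K ~> S) (a : S ~> J)
    (i : I ~> J) :
  is_kernel f k -> regular_epi a -> is_reg_image (a ∘ k) i -> is_normal i.
Proof.
move=> Hk Ha [Hi [e [He Ei]]].
have [R [r1 [r2 HR]]] := pullback_exists f f.
have [dR [dR1 dR2]] := pullback_lift HR (erefl (f ∘ idm S)).
have [P [p1 [p2 HP]]] := prod2_exists J J.
have [ar [ar1 ar2]] := prod2_pair (a ∘ r1) (a ∘ r2) HP.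
have [T [t [Ht [q [Hq Et]]]]] := reg_image_exists ar.
have HT : jointly_mono (p1 ∘ t) (p2 ∘ t).
  move=> X u v; rewrite -!comp_assoc => E1 E2.
  by apply: Ht; apply: (prod2_jointly_monic HP).
have qt1 : p1 ∘ t ∘ q = a ∘ r1 by rewrite -comp_assoc Et.
have qt2 : p2 ∘ t ∘ q = a ∘ r2 by rewrite -comp_assoc Et.
have [||d [_ d1 d2]] :=
    @regular_epi_fill_pair _ _ _ _ _ a _ _ (q ∘ dR) (idm J) (idm J) Ha HT.
- by rewrite comp_assoc qt1 -comp_assoc dR1 comp_idl comp_idr.
- by rewrite comp_assoc qt2 -comp_assoc dR2 comp_idl comp_idr.
have [D [g Hg]] := semi_abelian_exact (reflexive_relation_equivalence HT d1 d2).
exists D, g; apply: mono_kernel_intro => //.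
  (* The pair [(k, 0)] lies in the kernel pair of [f], so [g] identifies [a ∘ k] with 0. *)
  have [z Hz] := zero_mor_exists K S.
  have [|h [h1 h2]] := @pullback_lift _ _ _ _ _ _ _ _ _ k z HR.
    by apply: zero_mor_unique; [apply: kernel_zero | apply: zero_mor_compl].
  have [z' Hz'] := zero_mor_exists I D.
  suff -> : g ∘ i = z' by [].
  apply: (regular_epi_epi He); rewrite -comp_assoc Ei -h1.
  rewrite (comp_assoc h) -qt1 !comp_assoc -(comp_assoc t) Hg.1.
  rewrite -!comp_assoc (comp_assoc (q ∘ h)) (comp_assoc h) qt2 -comp_assoc h2.
  apply: zero_mor_unique; last by apply: zero_mor_compr.
  by do !apply: zero_mor_compl.
move=> X x Hx; have [z Hz] := zero_mor_exists X J.
have [|y [y1 y2]] := @pullback_lift _ _ _ _ _ _ _ _ _ x z Hg.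
  by apply: zero_mor_unique => //; apply: zero_mor_compl.
have [V [r [v HV]]] := pullback_exists q y.
have Hv := regular_epi_pullback HV Hq.
have Er1 : a ∘ (r1 ∘ r) = x ∘ v.
  by rewrite comp_assoc -qt1 -comp_assoc HV.1 comp_assoc y1.
have Er2 : is_zero_mor (a ∘ (r2 ∘ r)).
  rewrite comp_assoc -qt2 -comp_assoc HV.1 comp_assoc y2.
  exact: zero_mor_compr.
have [O [o1 [o2 HO]]] := prod2_exists B J.
have [fa [fa1 fa2]] := prod2_pair f a HO.
have [W [w [Hw [b [Hb Ew]]]]] := reg_image_exists fa.
have HW : jointly_mono (o1 ∘ w) (o2 ∘ w).
  move=> X' u' v'; rewrite -!comp_assoc => E1 E2.
  by apply: Hw; apply: (prod2_jointly_monic HO).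
have bw1 : o1 ∘ w ∘ b = f by rewrite -comp_assoc Ew.
have bw2 : o2 ∘ w ∘ b = a by rewrite -comp_assoc Ew.
have [zS HzS] := zero_mor_exists V S.
have [||c [c1 c2]] :=
  @difunctional _ _ _ (o1 ∘ w) (o2 ∘ w) V (b ∘ zS) (b ∘ (r2 ∘ r)) (b ∘ (r1 ∘ r)) HW.
- rewrite !(comp_assoc _ b) bw2; apply: zero_mor_unique => //.
  exact: zero_mor_compl.
- by rewrite !(comp_assoc _ b) bw1 !comp_assoc HR.1.
(* [c] is the element [(0, x)] of [W]. Locally it comes from some [s] with [f ∘ s = 0] and
   [a ∘ s = x]; the factorisation through [i] then descends because [i] is mono. *)
have [V' [s [v' HV']]] := pullback_exists b c.
have Hv' := regular_epi_pullback HV' Hb.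
have Hs : is_zero_mor (f ∘ s).
  rewrite -bw1 -comp_assoc HV'.1 comp_assoc c1; apply: zero_mor_compr.
  by do !apply: zero_mor_compl.
have [s' Es'] := kernel_lift Hk Hs.
have [||y' [_ Ey']] := @regular_epi_fill _ _ _ _ (v ∘ v') i (e ∘ s') x _ Hi.
- exact: regular_epi_comp.
- rewrite comp_assoc Ei -comp_assoc Es' -bw2 -comp_assoc HV'.1 comp_assoc c2.
  by rewrite (comp_assoc _ b) bw2 Er1 comp_assoc.
by exists y'.
Qed.

(** * Perfect objects *)

Definition is_coprod2 (A B S : C) (i1 : A ~> S) (i2 : B ~> S) : Prop :=
  forall Y (u : A ~> Y) (v : B ~> Y), exists! h : S ~> Y, h ∘ i1 = u /\ h ∘ i2 = v.

Lemma coprod2_exists (A B : C) : exists S (i1 : A ~> S) (i2 : B ~> S), is_coprod2 i1 i2.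
Proof.
have [_ [_ [_ /(_ A B) [S [inj H]]]]] := HC.
exists S, (inj true), (inj false) => Y u v.
have [h [Hh Uh]] := H Y (fun b => if b return (if b then A else B) ~> Y then u else v).
exists h; split; first by split; [apply: (Hh true) | apply: (Hh false)].
by move=> h' [E1 E2]; apply: Uh; case.
Qed.

Lemma coprod2_copair (A B S : C) (i1 : A ~> S) (i2 : B ~> S) Y (u : A ~> Y) (v : B ~> Y) :
  is_coprod2 i1 i2 -> exists h : S ~> Y, h ∘ i1 = u /\ h ∘ i2 = v.
Proof. by move=> /(_ Y u v) [h [? _]]; exists h. Qed.

Lemma coprod2_jointly_epic (A B S : C) (i1 : A ~> S) (i2 : B ~> S) Y (u v : S ~> Y) :
  is_coprod2 i1 i2 -> u ∘ i1 = v ∘ i1 -> u ∘ i2 = v ∘ i2 -> u = v.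
Proof.
move=> H E1 E2; have [h [_ U]] := H Y (u ∘ i1) (u ∘ i2).
by rewrite -(U u) // -(U v).
Qed.

Lemma prod2_axis_kernel (A B P : C) (p1 : P ~> A) (p2 : P ~> B) (l : A ~> P) :
  is_prod2 p1 p2 -> p1 ∘ l = idm A -> is_zero_mor (p2 ∘ l) -> is_kernel p2 l.
Proof.
move=> HP E1 E2; apply: mono_kernel_intro => //.
  by move=> X g h E; rewrite -(comp_idl g) -(comp_idl h) -E1 -!comp_assoc E.
move=> X g Hg; exists (p1 ∘ g); apply: (prod2_jointly_monic HP).
  by rewrite !comp_assoc E1 comp_idl.
by apply: zero_mor_unique => //; rewrite comp_assoc; apply: zero_mor_compr.
Qed.

(** Lifting the two coordinates along [q] one after the other gives a regular epi onto [P'] that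
    factors through [qq]. *)
Lemma prod2_map_regular_epi (A Q P P' : C) (q : A ~> Q) (p1 p2 : P ~> A)
    (p1' p2' : P' ~> Q) (qq : P ~> P') :
  regular_epi q -> is_prod2 p1 p2 -> is_prod2 p1' p2' ->
  p1' ∘ qq = q ∘ p1 -> p2' ∘ qq = q ∘ p2 -> regular_epi qq.
Proof.
move=> Hq HP HP' E1 E2; apply: regular_epi_of_strong => M m Hm [u Eu].
have [V [v1 [v2 HV]]] := pullback_exists q p1'.
have [V' [v1' [v2' HV']]] := pullback_exists q (p2' ∘ v2).
have [w [w1 w2]] := prod2_pair (v1 ∘ v2') v1' HP.
have Hv : regular_epi (v2 ∘ v2').
  apply: regular_epi_comp; first exact: regular_epi_pullback HV' Hq.
  exact: regular_epi_pullback HV Hq.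
have Ew : qq ∘ w = v2 ∘ v2'.
  apply: (prod2_jointly_monic HP'); rewrite comp_assoc ?E1 ?E2.
    by rewrite -comp_assoc w1 !comp_assoc HV.1.
  by rewrite -comp_assoc w2 HV'.1 comp_assoc.
have [|s [_ Es]] := @regular_epi_fill _ _ _ _ _ m (u ∘ w) (idm P') Hv Hm.
  by rewrite comp_assoc Eu Ew comp_idl.
by exists s.
Qed.

(* The quotient A -> Q by the binary commutator of A: the multiplication A x A -> Q is
   induced by the fold map of A + A, and it descends to Q x Q. *)
Lemma abelian_quotient (A S P K Q D : C) (i1 i2 : A ~> S) (p1 p2 : P ~> A) (g : S ~> P)
    (k : K ~> S) (fold : S ~> A) (q : A ~> Q) (d : D ~> A) :
  is_coprod2 i1 i2 -> is_prod2 p1 p2 ->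
  p1 ∘ g ∘ i1 = idm A -> is_zero_mor (p1 ∘ g ∘ i2) ->
  is_zero_mor (p2 ∘ g ∘ i1) -> p2 ∘ g ∘ i2 = idm A ->
  is_kernel g k -> fold ∘ i1 = idm A -> fold ∘ i2 = idm A ->
  regular_epi q -> is_kernel q d -> le_sub (fold ∘ k) d ->
  abelian_object Q.
Proof.
move=> HS HP g11 g12 g21 g22 Hk f1 f2 Hq Hd [u Eu].
have Hl : is_kernel p2 (g ∘ i1).
  by apply: (prod2_axis_kernel HP); rewrite comp_assoc.
have Hs : p2 ∘ (g ∘ i2) = idm A by rewrite comp_assoc.
have Hg : regular_epi g.
  apply: regular_epi_of_strong => M m Hm [v Ev].
  apply: (split_extension_strong Hs Hl Hm).
    by exists (v ∘ i1); rewrite comp_assoc Ev.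
  by exists (v ∘ i2); rewrite comp_assoc Ev.
have [|phi Ephi] := @regular_epi_cokernel _ _ _ _ g k (q ∘ fold) Hg Hk.
  rewrite -comp_assoc -Eu comp_assoc; apply: zero_mor_compr; exact: kernel_zero.
have phi1 : phi ∘ (g ∘ i1) = q.
  by rewrite comp_assoc Ephi -comp_assoc f1 comp_idr.
have phi2 : phi ∘ (g ∘ i2) = q.
  by rewrite comp_assoc Ephi -comp_assoc f2 comp_idr.
have [P' [p1' [p2' HP']]] := prod2_exists Q Q.
have [qq [qq1 qq2]] := prod2_pair (q ∘ p1) (q ∘ p2) HP'.
have Hqq := prod2_map_regular_epi Hq HP HP' qq1 qq2.
have [L [l HL]] := kernel_exists qq.
have [z Hz] := zero_mor_exists D D.
(* The kernel of [qq] factors through [D x D]; there [phi] vanishes because on either axis it is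
   [q ∘ d]. *)
have [phi' Ephi'] : exists h : P' ~> Q, h ∘ qq = phi.
  apply: (regular_epi_cokernel Hqq HL).
  have [E [e1 [e2 HE]]] := prod2_exists D D.
  have [dd [dd1 dd2]] := prod2_pair (d ∘ e1) (d ∘ e2) HP.
  have [j1 [j11 j12]] := prod2_pair (idm D) z HE.
  have [j2 [j21 j22]] := prod2_pair z (idm D) HE.
  have [|x1 Ex1] := @kernel_lift _ _ _ _ _ _ (p1 ∘ l) Hd.
    rewrite comp_assoc -qq1 -comp_assoc; apply: zero_mor_compl; exact: kernel_zero.
  have [|x2 Ex2] := @kernel_lift _ _ _ _ _ _ (p2 ∘ l) Hd.
    rewrite comp_assoc -qq2 -comp_assoc; apply: zero_mor_compl; exact: kernel_zero.
  have [x [xx1 xx2]] := prod2_pair x1 x2 HE.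
  have -> : l = dd ∘ x.
    apply: (prod2_jointly_monic HP); rewrite comp_assoc ?dd1 ?dd2 -comp_assoc.
      by rewrite xx1.
    by rewrite xx2.
  rewrite comp_assoc; apply: zero_mor_compr.
  have [o Ho] := zero_mor_exists E Q.
  suff -> : phi ∘ dd = o by [].
  have zdj a b : is_zero_mor a -> is_zero_mor b -> a = b :> (D ~> A).
    exact: zero_mor_unique.
  have Hj1 : is_kernel e2 j1 by apply: (prod2_axis_kernel HE) => //; rewrite j12.
  have Ed1 : dd ∘ j1 = g ∘ i1 ∘ d.
    apply: (prod2_jointly_monic HP); rewrite !comp_assoc ?dd1 ?dd2 -comp_assoc.
      by rewrite j11 g11 comp_idr comp_idl.
    rewrite j12; apply: zdj; first exact: zero_mor_compl.
    exact: zero_mor_compr.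
  have Ed2 : dd ∘ j2 = g ∘ i2 ∘ d.
    apply: (prod2_jointly_monic HP); rewrite !comp_assoc ?dd1 ?dd2 -comp_assoc.
      rewrite j21; apply: zdj; first exact: zero_mor_compl.
      exact: zero_mor_compr.
    by rewrite j22 g22 comp_idr comp_idl.
  have Hqd := kernel_zero Hd.
  apply: (split_extension_jointly_epic j22 Hj1); rewrite -comp_assoc ?Ed1 ?Ed2.
    rewrite comp_assoc phi1; apply: zero_mor_unique => //; exact: zero_mor_compr.
  rewrite comp_assoc phi2; apply: zero_mor_unique => //; exact: zero_mor_compr.
have [zQ HzQ] := zero_mor_exists Q Q.
have [j1 [j11 j12]] := prod2_pair (idm Q) zQ HP'.
have [j2 [j21 j22]] := prod2_pair zQ (idm Q) HP'.
exists P', (fun b : bool => if b return P' ~> (if b then Q else Q) then p1' else p2').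
exists j1, j2, phi'; split.
  move=> Y f; have [h [[h1 h2] Uh]] := HP' Y (f true) (f false).
  exists h; split; first by case.
  by move=> h' H'; apply: Uh; split; [apply: (H' true) | apply: (H' false)].
have Eq1 : j1 ∘ q = qq ∘ (g ∘ i1).
  apply: (prod2_jointly_monic HP'); rewrite !comp_assoc ?qq1 ?qq2 ?j11 ?j12.
    by rewrite -!comp_assoc (comp_assoc i1) g11 comp_idl comp_idr.
  apply: zero_mor_unique; first exact: zero_mor_compr.
  by rewrite -!comp_assoc (comp_assoc i1); apply: zero_mor_compl.
have Eq2 : j2 ∘ q = qq ∘ (g ∘ i2).
  apply: (prod2_jointly_monic HP'); rewrite !comp_assoc ?qq1 ?qq2 ?j21 ?j22.
    apply: zero_mor_unique; first exact: zero_mor_compr.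
    by rewrite -!comp_assoc (comp_assoc i2); apply: zero_mor_compl.
  by rewrite -!comp_assoc (comp_assoc i2) g22 comp_idl comp_idr.
split=> //; split; first by rewrite j12.
split; first by rewrite j21.
split=> //; split; apply: (regular_epi_epi Hq); rewrite -comp_assoc ?Eq1 ?Eq2.
  by rewrite comp_assoc Ephi' phi1 comp_idl.
by rewrite comp_assoc Ephi' phi2 comp_idl.
Qed.

(** [k] is the binary cosmash product, the kernel of [A + A -> A x A]. Its image under the fold map
    is normal with abelian, hence zero, quotient. A map killing one summand factors through the
    retraction onto the other, and both retractions kill [k]. *)
Lemma perfect_of_only_zero_abelian (A S : C) (i1 i2 : A ~> S) (fold : S ~> A) :
  only_zero_abelian C ->
  is_coprod2 i1 i2 -> fold ∘ i1 = idm A -> fold ∘ i2 = idm A ->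
  exists K (k : K ~> S), regular_epi (fold ∘ k) /\
    forall Y (h : S ~> Y), is_zero_mor (h ∘ i1) \/ is_zero_mor (h ∘ i2) ->
      is_zero_mor (h ∘ k).
Proof.
move=> Hab HS f1 f2.
have [P [p1 [p2 HP]]] := prod2_exists A A.
have [z Hz] := zero_mor_exists A A.
have [s1 [s11 s12]] := coprod2_copair (idm A) z HS.
have [s2 [s21 s22]] := coprod2_copair z (idm A) HS.
have [g [g1 g2]] := prod2_pair s1 s2 HP.
have [K [k Hk]] := kernel_exists g.
have Hsk1 : is_zero_mor (s1 ∘ k).
  by rewrite -g1 -comp_assoc; apply: zero_mor_compl; apply: kernel_zero.
have Hsk2 : is_zero_mor (s2 ∘ k).
  by rewrite -g2 -comp_assoc; apply: zero_mor_compl; apply: kernel_zero.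
exists K, k; split; last first.
  move=> Y h [H|H].
    have -> : h = h ∘ i2 ∘ s2.
      apply: (coprod2_jointly_epic HS); rewrite -comp_assoc ?s21 ?s22 ?comp_idr //.
      by apply: zero_mor_unique => //; apply: zero_mor_compl.
    by rewrite -comp_assoc; apply: zero_mor_compl.
  have -> : h = h ∘ i1 ∘ s1.
    apply: (coprod2_jointly_epic HS); rewrite -comp_assoc ?s11 ?s12 ?comp_idr //.
    by apply: zero_mor_unique => //; apply: zero_mor_compl.
  by rewrite -comp_assoc; apply: zero_mor_compl.
have [D [d Hd]] := reg_image_exists (fold ∘ k).
have Hfold : regular_epi fold := split_epi_regular f1.
have [H [h Hh]] := reg_image_kernel_normal Hk Hfold Hd.
have [Q [m [Hm [q [Hq Emq]]]]] := reg_image_exists h.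
have [Md [e [He Ee]]] := Hd.
have Hqd : is_kernel q d.
  apply: mono_kernel_intro => //.
    by apply: (zero_mor_mono Hm); rewrite comp_assoc Emq; apply: kernel_zero.
  move=> X x Hx; apply: (kernel_lift Hh); rewrite -Emq -comp_assoc.
  exact: zero_mor_compl.
have HQ : abelian_object Q.
  apply: (@abelian_quotient _ _ _ _ _ _ i1 i2 p1 p2 g k fold q d) => //;
    rewrite ?g1 ?g2 ?s12 ?s21 //.
  by exists e.
have [|s Es] := @kernel_lift _ _ _ _ _ _ (idm A) Hqd.
  by rewrite comp_idr; apply: zero_mor_to_zero; apply: Hab.
by rewrite -Ee; apply: regular_epi_comp => //; apply: split_epi_regular Es.
Qed.

(** * Direct images of meets of kernels *)

(* r factors, locally on P, through the direct image along a of the joint kernel of the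
   maps f k with k in l. *)
Definition covered (I : eqType) (Y : I -> C) (S J P : C) (f : forall k, S ~> Y k)
    (a : S ~> J) (r : P ~> J) (l : seq I) : Prop :=
  exists P' (q : P' ~> P) (t : P' ~> S),
    [/\ regular_epi q, a ∘ t = r ∘ q & forall k, k \in l -> is_zero_mor (f k ∘ t)].

(* This is where perfectness enters: t1 and t2 lift r through K1 and K2, and precomposing
   [t1, t2] with the binary cosmash product lands in the meet of K1 and K2. *)
Lemma covered_cat (I : eqType) (Y : I -> C) (S J P : C) (f : forall k, S ~> Y k)
    (a : S ~> J) (r : P ~> J) (l1 l2 : seq I) :
  only_zero_abelian C ->
  covered f a r l1 -> covered f a r l2 -> covered f a r (l1 ++ l2).
Proof.
move=> Hab [P1 [q1 [t1 [Hq1 E1 H1]]]] [P2 [q2 [t2 [Hq2 E2 H2]]]].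
have [V [v1 [v2 HV]]] := pullback_exists q1 q2.
have Hv2 := regular_epi_pullback HV Hq1.
have [T [i1 [i2 HT]]] := coprod2_exists V V.
have [fold [f1 f2]] := coprod2_copair (idm V) (idm V) HT.
have [t [Et1 Et2]] := coprod2_copair (t1 ∘ v1) (t2 ∘ v2) HT.
have [K [k [Hk Zk]]] := perfect_of_only_zero_abelian Hab HT f1 f2.
exists K, (q2 ∘ v2 ∘ (fold ∘ k)), (t ∘ k); split.
- by apply: regular_epi_comp => //; apply: regular_epi_comp.
- rewrite !comp_assoc; congr (_ ∘ _); apply: (coprod2_jointly_epic HT).
    rewrite -!comp_assoc Et1 f1 comp_idr comp_assoc E1 -comp_assoc HV.1.
    by rewrite !comp_assoc.
  by rewrite -!comp_assoc Et2 f2 comp_idr !comp_assoc E2.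
- move=> x; rewrite mem_cat comp_assoc => /orP [/H1|/H2] Hx; apply: Zk.
    by left; rewrite -comp_assoc Et1 comp_assoc; apply: zero_mor_compr.
  by right; rewrite -comp_assoc Et2 comp_assoc; apply: zero_mor_compr.
Qed.

Lemma covered_all (I : eqType) (Y : I -> C) (S J P : C) (f : forall k, S ~> Y k)
    (a : S ~> J) (r : P ~> J) (k0 : I) (l : seq I) :
  only_zero_abelian C ->
  (forall k, covered f a r [:: k]) -> covered f a r (k0 :: l).
Proof.
move=> Hab H; elim: l k0 => [|k l IH] k0; first exact: H.
by rewrite -cat1s; apply: covered_cat.
Qed.

(** * The meet formula *)

(** A subobject of [J] through which [a] factors contains every [X i], hence the whole join. *)
Lemma coprod_join_regular_epi n (X : 'I_n -> C) (A S J : C) (x : forall i, X i ~> A)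
    (j : J ~> A) (xJ : forall i, X i ~> J) (inj : forall i, X i ~> S) (a : S ~> J) :
  is_join x j -> (forall i, j ∘ xJ i = x i) -> (forall i, a ∘ inj i = xJ i) ->
  regular_epi a.
Proof.
move=> [Hj [_ Uj]] ExJ Ea; apply: regular_epi_of_strong => M m Hm [u Eu].
have [|i|s Es] := Uj M (j ∘ m); first exact: mono_comp.
  by exists (u ∘ inj i); rewrite -comp_assoc (comp_assoc _ u) Eu Ea.
by exists s; apply: Hj; rewrite comp_assoc Es comp_idr.
Qed.

Lemma meet_formula_of_only_zero_abelian :
  only_zero_abelian C -> higgins_meet_formula C.
Proof.
move=> Hab n Hn A X x Hx Cm c [S [inj [K [kk [a [Hcos [Ea Hc]]]]]]].
move=> J j Hj xJ ExJ N nc Hnc M m Hm.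
have [HS [Sk [injk [P [pr [cm [HSk [HP [cm1 [cm0 Hkk]]]]]]]]]] := Hcos.
have [Hcm [e [He Ece]]] := Hc.
have Hjm := Hj.1.
have [b [Eb _]] := HS J xJ.
have Ejb : a = j ∘ b.
  have [h [_ U]] := HS A x; rewrite -(U a) //; apply: U => i.
  by rewrite -comp_assoc Eb.
have Hb := coprod_join_regular_epi Hj ExJ Eb.
split.
  (* First inclusion: [c] factors through [j] as [c'], which must be shown to lie in each normal
     closure. *)
  have [|c' [Ec'1 Ec'2]] := @regular_epi_fill _ _ _ _ e j (b ∘ kk) c He Hjm.
    by rewrite comp_assoc -Ejb.
  have Hc' : mono c' by apply: (@mono_comp_inv _ _ _ j); rewrite Ec'2.
  have [|w Ew] := Hm.2.2 _ c' Hc'; last by exists w; rewrite -comp_assoc Ew.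
  move=> i; have [[B [h Hh]] [[y Ey] _]] := Hnc i.
  apply: (kernel_lift Hh).
  have [psi [Epsi _]] := HSk i B (fun l => h ∘ xJ (proj1_sig l)).
  (* [h] kills [xJ i], so [h ∘ b] factors through the coproduct of the other summands and vanishes
     on the cosmash product. *)
  have Ehb : h ∘ b = psi ∘ (pr i ∘ cm).
    have [h0 [_ U]] := HS B (fun l => h ∘ xJ l).
    rewrite -(U (h ∘ b)); last by move=> l; rewrite -comp_assoc Eb.
    apply: U => l; have [->|Hl] := eqVneq l i.
      apply: zero_mor_unique; first by rewrite -comp_assoc; apply: zero_mor_compl.
      by rewrite -Ey comp_assoc; apply: zero_mor_compr; apply: kernel_zero.
    by rewrite -comp_assoc (cm1 i l Hl) (Epsi (exist _ l Hl)).
  have [z Hz] := zero_mor_exists Cm B.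
  suff -> : h ∘ c' = z by [].
  apply: (regular_epi_epi He); apply: zero_mor_unique; last exact: zero_mor_compr.
  rewrite -comp_assoc Ec'1 comp_assoc Ehb -!comp_assoc.
  by do 2!apply: zero_mor_compl; apply: kernel_zero.
(* Converse inclusion: by minimality [nc i] lies in the normal image [ii], so [m] lifts to the
   kernel [l] after pulling back [eI]. *)
have Hcov i : covered (fun k => pr k ∘ cm) b m [:: i].
  have [L [l Hl]] := kernel_exists (pr i ∘ cm).
  have [I [ii Hii]] := reg_image_exists (b ∘ l).
  have HN := reg_image_kernel_normal Hl Hb Hii.
  have [Mii [eI [HeI EeI]]] := Hii.
  have [y Ey] := kernel_lift Hl (cm0 i).
  have [_ [_ /(_ _ ii HN) [|u Eu]]] := Hnc i.
    by exists (eI ∘ y); rewrite comp_assoc EeI -comp_assoc Ey Eb.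
  have [v Ev] := Hm.2.1 i.
  have [P' [t [q HP']]] := pullback_exists eI (u ∘ v).
  exists P', q, (l ∘ t); split.
  - exact: regular_epi_pullback HP' HeI.
  - by rewrite comp_assoc -EeI -comp_assoc HP'.1 !comp_assoc Eu Ev.
  - move=> k; rewrite inE => /eqP ->; rewrite comp_assoc.
    by apply: zero_mor_compr; apply: kernel_zero.
(* [covered_all] takes a nonempty list; repeating [i0] in front of the enumeration is harmless. *)
have i0 : 'I_n by case: (n) Hn => // n' _; exact: ord0.
have [P' [q [t [Hq Et Ht]]]] := covered_all i0 (enum 'I_n) Hab Hcov.
(* Every component of [cm] kills [t], so [t] factors through the cosmash product. *)
have [|v Ev] := @kernel_lift _ _ _ _ _ _ t Hkk.
  have [z Hz] := zero_mor_exists P' P.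
  suff -> : cm ∘ t = z by [].
  have [h [_ U]] := HP P' (fun k => pr k ∘ z).
  rewrite -(U z) //; symmetry; apply: U => k.
  apply: zero_mor_unique; last exact: zero_mor_compl.
  by rewrite comp_assoc; apply: Ht; rewrite inE mem_enum orbT.
have [|d [_ Ed]] := @regular_epi_fill _ _ _ _ q c (e ∘ v) (j ∘ m) Hq Hcm.
  by rewrite comp_assoc Ece -comp_assoc Ev Ejb -comp_assoc Et comp_assoc.
by exists d.
Qed.

(** * From (ii) to (iii), and from (iii) back to (i) *)

Lemma perfect_of_meet_formula : higgins_meet_formula C -> all_perfect C.
Proof.
move=> H n Hn A Cm c Hc.
have i0 : 'I_n by case: (n) Hn => // n' _; exact: ord0.
have Hid : mono (idm A) by move=> X g h; rewrite !comp_idl.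
have le_id X (f : X ~> A) : le_sub f (idm A) by exists f; rewrite comp_idl.
have Hn_id : is_normal (idm A).
  have [z Hz] := zero_mor_exists A A.
  exists A, z; apply: mono_kernel_intro => //; exact: zero_mor_compr.
(* With every [X i] equal to [A], the join, the normal closures and their meet can all be taken to
   be [idm A]; the target becomes [j ∘ m]. *)
rewrite -[X in eq_sub _ X]comp_idl.
apply: (H n Hn A (fun=> A) (fun=> idm A) _ _ c Hc A (idm A) _ (fun=> idm A) _
          (fun=> A) (fun=> idm A)) => //.
- by split=> //; split=> // M m Hm /(_ i0).
- by move=> _; rewrite comp_idl.
Qed.

(** For abelian [A] the fold map factors through [g : A + A -> A x A], so it kills the kernel of [g]
    and [[A,A] = 0], while perfectness gives [[A,A] = A]. *)
Lemma only_zero_abelian_of_perfect : all_perfect C -> only_zero_abelian C.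
Proof.
move=> H A [P [pr [j1 [j2 [phi [HP [E11 [E12 [E21 [E22 [F1 F2]]]]]]]]]]].
have [S [i1 [i2 HS]]] := coprod2_exists A A.
have [s1 [s11 s12]] := coprod2_copair (idm A) (pr true ∘ j2) HS.
have [s2 [s21 s22]] := coprod2_copair (pr false ∘ j1) (idm A) HS.
have [fold [f1 f2]] := coprod2_copair (idm A) (idm A) HS.
have [g [g1 g2]] := coprod2_copair j1 j2 HS.
pose inj (i : 'I_2) : A ~> S := if i == ord0 then i1 else i2.
(* Omitting the index 0 leaves the second summand. *)
pose pr' (i : 'I_2) : P ~> A := if i == ord0 then pr false else pr true.
have [K [kk Hkk]] := kernel_exists g.
have [Cm [c Hc]] := reg_image_exists (fold ∘ kk).
(* As an equality of booleans, the condition can be settled by cases on [k == ord0] and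
   [l == ord0]. *)
have neq_eq (k l : 'I_2) : (l != k) = ((l == ord0) == (k != ord0)).
  by move: k l; do 2![case; case=> [|[|?]] //= ?].
have I2_eq (k i l : 'I_2) : i != k -> l != k -> i = l.
  move=> Hi Hl; apply: val_inj; move: k i l Hi Hl.
  by do 3![case; case=> [|[|?]] //= ?].
have I2_max (i : 'I_2) : i != ord0 -> i = ord_max by move=> Hi; apply: (I2_eq ord0).
have Hh : is_higgins (X := fun _ : 'I_2 => A) (fun _ => idm A) c.
  exists S, inj, K, kk, fold; split; last first.
    by split=> // i; rewrite /inj; case: ifP.
  split.
    move=> Y f; have [h [[h1 h2] U]] := HS Y (f ord0) (f ord_max).
    exists h; split.
      by move=> i; rewrite /inj; case: eqVneq => [->//|/I2_max ->].
    by move=> h' Hh'; apply: U; split; [apply: (Hh' ord0) | apply: (Hh' ord_max)].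
  (* Omitting one of two indices leaves a single summand, so each partial coproduct is [A] with
     identity injection. *)
  exists (fun=> A), (fun _ _ => idm A), P, pr', g; split.
    move=> k Y f.
    have [j0 Hj0] : exists j : 'I_2, j != k.
      exists (if k == ord0 then ord_max else ord0).
      by case: (eqVneq k ord0) => [->|] //; rewrite eq_sym.
    exists (f (exist _ j0 Hj0)); split.
      move=> l; rewrite comp_idr; congr f; case: l => l Hl.
      have E : j0 = l := I2_eq k j0 l Hj0 Hl.
      by case: _ / E Hl => Hl; rewrite (bool_irrelevance Hj0 Hl).
    by move=> h' /(_ (exist _ j0 Hj0)); rewrite comp_idr.
  split.
    move=> Y f; have [h [Hh U]] := HP Y (fun b => if b return Y ~> (if b then A else A)
      then f ord_max else f ord0).
    exists h; split.
      move=> i; rewrite /pr'; case: eqVneq => [->|/I2_max ->]; first exact: (Hh false).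
      exact: (Hh true).
    move=> h' Hh'; apply: U; case; first exact: (Hh' ord_max).
    exact: (Hh' ord0).
  split.
    move=> k l; rewrite neq_eq /pr' /inj -comp_assoc.
    by case: (k == ord0); case: (l == ord0) => //= _; rewrite ?g1 ?g2 //.
  split; last done.
  by move=> k; rewrite /pr' /inj; case: (k == ord0); rewrite -comp_assoc ?g1 ?g2.
have Efold : fold = phi ∘ g.
  by apply: (coprod2_jointly_epic HS); rewrite -comp_assoc ?g1 ?g2 ?f1 ?f2.
have [_ [s Es]] := H 2 (leqnn 2) A Cm c Hh.
have [Hcm [e [He Ece]]] := Hc.
apply: zero_obj_of_idm; rewrite -Es; apply: zero_mor_compr.
have [z Hz] := zero_mor_exists Cm A.
suff -> : c = z by [].
apply: (regular_epi_epi He); rewrite Ece Efold -comp_assoc.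
apply: zero_mor_unique; last exact: zero_mor_compr.
by apply: zero_mor_compl; apply: kernel_zero.
Qed.

End SemiAbelian.

Theorem mainTheorem8 (C : Category) (HC : semi_abelian C) :
  (only_zero_abelian C <-> higgins_meet_formula C) /\
  (only_zero_abelian C <-> all_perfect C).
Proof.
have i_ii := meet_formula_of_only_zero_abelian HC.
have ii_iii := perfect_of_meet_formula HC.
have iii_i := only_zero_abelian_of_perfect HC.
by tauto.
Qed.
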